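(* Let $(X_n)$ be a sequence of finite sets and let $(\mathcal{F}_n)$ be a sequence of nontrivial upper sets $\mathcal{F}_n \subseteq 2^{X_n}$. Let $K>0$ be a constant such that $p_c(\mathcal{F}_n)\leq K q(\mathcal{F}_n)\log \ell(\mathcal{F}_n)$ for all $n$. (i) If $\dim(\mathcal{F}_n)>\frac12\big(K\log\ell(\mathcal{F}_n)\big)^{\ell(\mathcal{F}_n)}$ for all sufficiently large $n$, then the Kahn-Kalai bounds provide nontrivial information for $(\mathcal{F}_n)$. (ii) If $\log\ell(\mathcal{F}_n)\ll(2\dim(\mathcal{F}_n))^{1/\ell(\mathcal{F}_n)}$, then the Kahn-Kalai bounds provide asymptotically perfect information for $(\mathcal{F}_n)$.
   Context: For a finite set $X$, an upper set is a subset $\mathcal{F}\subseteq 2^X$ such that $A\in\mathcal{F}$ and $A\subseteq B\subseteq X$ imply $B\in\mathcal{F}$; it is nontrivial if $\mathcal{F}\neq\emptyset$ and $\mathcal{F}\neq 2^X$. For $p\in[0,1]$ let $\mu_p(\mathcal{F})=\sum_{S\in\mathcal{F}}p^{|S|}(1-p)^{|X|-|S|}$; for nontrivial $\mathcal{F}$, the critical probability $p_c(\mathcal{F})$ is the unique $p\in[0,1]$ with $\mu_p(\mathcal{F})=\frac12$. For $S\subseteq X$ let $\langle S\rangle=\{T\subseteq X: S\subseteq T\}$, and for $\mathcal{G}\subseteq 2^X$ let $\langle\mathcal{G}\rangle=\bigcup_{S\in\mathcal{G}}\langle S\rangle$. A set $\mathcal{G}\subseteq 2^X$ is a cover of $\mathcal{F}$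 if $\mathcal{F}\subseteq\langle\mathcal{G}\rangle$. $\mathcal{F}$ is $p$-small if it has a cover $\mathcal{G}$ with $\sum_{S\in\mathcal{G}}p^{|S|}\leq\frac12$. The expectation threshold $q(\mathcal{F})$ is the largest $p\in[0,1]$ for which $\mathcal{F}$ is $p$-small. The covering dimension is $\dim(\mathcal{F})=\min\{|\mathcal{G}|:\mathcal{G}\subseteq2^X,\ \mathcal{F}\subseteq\langle\mathcal{G}\rangle\neq2^X\}$. $\mathcal{F}_0$ denotes the set of (inclusion-)minimal elements of $\mathcal{F}$, $\ell_0(\mathcal{F})=\max\{|S|:S\in\mathcal{F}_0\}$ and $\ell(\mathcal{F})=\max\{\ell_0(\mathcal{F}),2\}$. $\log$ is the logarithm to base 2. For positive sequences, $a_n\ll b_n$ means $a_n/b_n\to0$. The Kahn-Kalai bounds $q(\mathcal{F}_n)\leq p_c(\mathcal{F}_n)\leq Kq(\mathcal{F}_n)\log\ell(\mathcal{F}_n)$ provide nontrivial information for $(\mathcal{F}_n)$ if there exists $N$ such that $Kq(\mathcal{F}_n)\log\ell(\mathcal{F}_n)<1$ for all $n\geq N$; they provide asymptotically perfect information if $\lim_{n\to\infty}(K\log\ell(\mathcal{F}_n)-1)q(\mathcal{F}_n)=0$. *)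

(* Defs.v *)
From mathcomp Require Import all_boot all_order all_algebra.
From mathcomp Require Import mathcomp_extra boolp classical_sets reals.
From mathcomp Require Import topology normedtype sequences exp.

Set Implicit Arguments.
Unset Strict Implicit.
Unset Printing Implicit Defensive.

Import Order.TTheory GRing.Theory Num.Theory.
Import numFieldNormedType.Exports.

Local Open Scope classical_set_scope.
Local Open Scope ring_scope.

Section UpperSets.
Variable X : finType.
Implicit Types (F G : {set {set X}}) (S T : {set X}).

Definition upper_set F : Prop :=
  forall S T, S \in F -> S \subset T -> T \in F.

Definition nontrivial F : Prop := F <> finset.set0 /\ F <> [set: {set X}]%SET.

(* [<S>] and [<G>], the upper sets generated by S and by G *)
Definition upset1 S : {set {set X}} := [set T : {set X} | S \subset T]%SET.

Definition upset G : {set {set X}} := (\bigcup_(S in G) upset1 S)%SET.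

Definition is_cover F G : bool := F \subset upset G.

(* [arg min] needs a witness; F itself is one as soon as F is a nontrivial
   upper set, for then [upset F = F]. *)
Definition covering_dim F : nat :=
  #|[arg min_(G < F | is_cover F G && (upset G != [set: {set X}]%SET)) #|G|]%N|.

Definition minimal_elements F : {set {set X}} :=
  [set S : {set X} | minset (mem F) S]%SET.

Definition ell0 F : nat := (\max_(S in minimal_elements F) #|S|)%N.

Definition ell F : nat := maxn (ell0 F) 2.

Variable R : realType.
Implicit Type p : R.

Definition mu p F : R := \sum_(S in F) p ^+ #|S| * (1 - p) ^+ (#|X| - #|S|).

(* For a nontrivial upper set this set is a singleton, [mu p F] being
   continuous and strictly increasing in p, from 0 to 1. *)
Definition critical_probability F : R :=
  xget 0 [set p | 0 <= p <= 1 /\ mu p F = 2^-1].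

Definition p_small p F : Prop :=
  exists G, is_cover F G /\ \sum_(S in G) p ^+ #|S| <= 2^-1.

Definition p_small_set F : set R := [set p | 0 <= p <= 1 /\ p_small p F].

(* The maximum of [p_small_set F], which exists when F is a nontrivial upper
   set: [p_small_set F] is then compact and contains 0. *)
Definition expectation_threshold F : R :=
  xget 0 (p_small_set F `&` ubound (p_small_set F)).

End UpperSets.

Arguments critical_probability {X} R F.
Arguments expectation_threshold {X} R F.

Definition log2 {R : realType} (x : R) : R := ln x / ln 2.

(* [a_n << b_n] *)
Definition negligible_wrt {R : realType} (a b : nat -> R) : Prop :=
  (fun n => a n / b n) @ \oo --> (0 : R).

Section KahnKalai.
Variables (R : realType) (K : R) (X : nat -> finType).
Variable F : forall n, {set {set X n}}.

Definition KK_nontrivial_information : Prop :=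
  exists N : nat, forall n : nat, (N <= n)%N ->
    K * expectation_threshold R (F n) * log2 (ell (F n))%:R < 1.

Definition KK_asymptotically_perfect_information : Prop :=
  (fun n => (K * log2 (ell (F n))%:R - 1) * expectation_threshold R (F n))
    @ \oo --> (0 : R).

End KahnKalai.

(* Main.v *)
Require Import Defs.
From mathcomp Require Import all_boot all_order all_algebra.
From mathcomp Require Import mathcomp_extra boolp classical_sets reals.
From mathcomp Require Import topology normedtype sequences exp.

Import Order.TTheory GRing.Theory Num.Theory.
Import numFieldNormedType.Exports.

Local Open Scope classical_set_scope.
Local Open Scope ring_scope.

(** Discarding from a cover of F the sets larger than ell F leaves a cover, since
    every element of F contains a minimal one.  So if q = q(F) and G is a cover
    with weight at most 1/2, the at least dim F remaining sets have weight at
    least q^ell each: dim(F) q^ell <= 1/2, i.e. q <= (2 dim F)^(-1/ell).  Both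
    claims follow from this bound. *)

Section Covers.
Set Implicit Arguments.
Unset Strict Implicit.

Variable X : finType.
Implicit Types (F G : {set {set X}}) (S T : {set X}).

Lemma in_upset G T : reflect (exists2 S, S \in G & S \subset T) (T \in upset G).
Proof.
by apply: (iffP bigcupP) => -[S SG]; rewrite ?inE => ST; exists S; rewrite ?inE.
Qed.

(** The empty set lies below every set, and nothing else lies below it. This turns the properness
    condition in [covering_dim] into a membership test. *)
Lemma upset_neqT G : (upset G != [set: {set X}]%SET) = (finset.set0 \notin G).
Proof.
congr negb; apply/eqP/idP => [GT | G0].
  have /in_upset[S SG] : finset.set0 \in upset G by rewrite GT inE.
  by rewrite finset.subset0 => /eqP <-.
apply/setP => T; rewrite finset.in_setT; apply/in_upset.
by exists finset.set0 => //; exact: finset.sub0set.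
Qed.

Lemma nontrivial_cover_self F : upper_set F -> nontrivial F ->
  is_cover F F && (upset F != [set: {set X}]%SET).
Proof.
move=> Fup [_ FT]; apply/andP; split.
  by apply/fintype.subsetP => S SF; apply/in_upset; exists S.
rewrite upset_neqT; apply/negP => F0; apply: FT; apply/setP => T.
by rewrite finset.in_setT (Fup _ _ F0) ?finset.sub0set.
Qed.

Lemma covering_dim_le F G : upper_set F -> nontrivial F ->
  is_cover F G -> finset.set0 \notin G -> (covering_dim F <= #|G|)%N.
Proof.
move=> Fup Fnt FG G0; rewrite /covering_dim.
case: arg_minnP => [|H _ minH]; first exact: nontrivial_cover_self.
by apply: minH; rewrite FG upset_neqT.
Qed.

(** A nonempty [F] has no empty cover. Positivity is what later allows division by the root of
    [2 * covering_dim F]. *)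
Lemma covering_dim_gt0 F : upper_set F -> nontrivial F -> (0 < covering_dim F)%N.
Proof.
move=> Fup Fnt; rewrite /covering_dim.
case: arg_minnP => [|G /andP[FG _] _]; first exact: nontrivial_cover_self.
have /set0Pn[T TF] : F != finset.set0 by apply/eqP; case: Fnt.
have /in_upset[S SG _] := fintype.subsetP FG T TF.
by apply/card_gt0P; exists S.
Qed.

Lemma is_cover_ell F G :
  is_cover F G -> is_cover F [set S in G | (#|S| <= ell F)%N]%SET.
Proof.
move=> FG; apply/fintype.subsetP => T TF.
(* The covering set is taken below a minimal [M] inside [T], not merely below [T], so that
   [#|S| <= #|M| <= ell0 F]. *)
have [M Mmin MT] := @minset_exists _ (mem F) T TF.
have /in_upset[S SG SM] := fintype.subsetP FG M (minsetp Mmin).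
apply/in_upset; exists S; last exact: fintype.subset_trans SM MT.
rewrite inE SG (leq_trans (subset_leq_card SM)) // leq_max; apply/orP; left.
by apply: (@leq_bigmax_cond _ (mem (minimal_elements F)) (fun S => #|S|) M); rewrite !inE.
Qed.

Variable R : realType.

Lemma covering_dim_p_small F (p : R) : upper_set F -> nontrivial F ->
  0 <= p <= 1 -> p_small p F -> (covering_dim F)%:R * p ^+ ell F <= 2^-1.
Proof.
move=> Fup Fnt /andP[p0 p1] [G [FG Gp]].
set H : {set {set X}} := [set S in G | (#|S| <= ell F)%N]%SET.
(* The empty set alone would contribute [p ^+ 0 = 1], more than the permitted weight 1/2. *)
have G0 : finset.set0 \notin G.
  apply/negP => G0; move: Gp; apply/negP; rewrite -ltNge.
  rewrite (bigD1 _ G0) /= cards0 expr0 ltr_wpDr ?invf_lt1 ?ltr1n //.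
  by apply: sumr_ge0 => S _; exact: exprn_ge0.
have H0 : finset.set0 \notin H by rewrite inE (negbTE G0).
apply: le_trans Gp.
apply: (@le_trans _ _ (#|H|%:R * p ^+ ell F)).
  rewrite ler_wpM2r ?exprn_ge0 // ler_nat covering_dim_le //.
  exact: is_cover_ell.
(* Split the weight of [G] by size: the large sets contribute a nonnegative amount, and each small
   one at least [p ^+ ell F] since [p <= 1]. *)
rewrite mulr_natl -sumr_const [leRHS](bigID (fun S => #|S| <= ell F)%N) /=.
rewrite ler_wpDr ?sumr_ge0 // => [S _|]; first exact: exprn_ge0.
rewrite (eq_bigl (fun S => (S \in G) && (#|S| <= ell F)%N)).
  by apply: ler_sum => S /andP[_ Sl]; exact: ler_wiXn2l.
by move=> S; rewrite inE.
Qed.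

Lemma ell_ge2 F : (2 <= ell F)%N.
Proof. exact: leq_maxr. Qed.

Lemma ell_gt0 F : (0 < ell F)%N.
Proof. exact: ltnW (ell_ge2 F). Qed.

(** This is where the maximum with 2 in [ell] enters; it lets additive constants be absorbed into
    the logarithm. *)
Lemma log2_ell_ge1 F : 1 <= log2 (ell F)%:R :> R.
Proof.
rewrite /log2 ler_pdivlMr ?ln_gt0 ?ltr1n // mul1r.
by rewrite ler_ln ?posrE ?ltr0n ?ler_nat ?ell_gt0 ?ell_ge2.
Qed.

Lemma expectation_threshold_ge0 F : 0 <= expectation_threshold R F.
Proof. by rewrite /expectation_threshold; case: xgetP => // q _ [[/andP[]]]. Qed.

Lemma covering_dim_expectation_threshold F : upper_set F -> nontrivial F ->
  (covering_dim F)%:R * expectation_threshold R F ^+ ell F <= 2^-1.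
Proof.
move=> Fup Fnt; rewrite /expectation_threshold.
case: xgetP => [q _ [[q01 qF] _]|_]; first exact: covering_dim_p_small.
(* In the default branch [xget] returns 0, and [0 ^+ ell F] is 0 because [ell F] is positive. *)
by rewrite expr0n eqn0Ngt ell_gt0 mulr0 invr_ge0.
Qed.

(** Take [ell F]-th roots in the previous bound. The inverse stays outside the power to match the
    quotient in [negligible_wrt]. *)
Lemma expectation_threshold_le F : upper_set F -> nontrivial F ->
  expectation_threshold R F <= ((2 * (covering_dim F)%:R) `^ (ell F)%:R^-1)^-1.
Proof.
move=> Fup Fnt; set d := 2 * _; set q := expectation_threshold R F.
have d0 : 0 < d by rewrite mulr_gt0 ?ltr0n ?covering_dim_gt0.
have r0 := powR_gt0 (ell F)%:R^-1 d0.
have rX : (d `^ (ell F)%:R^-1) ^+ ell F = d.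
  rewrite -powR_mulrn ?ltW // -powRrM mulVf ?pnatr_eq0 -?lt0n ?ell_gt0 //.
  by rewrite powRr1 ?ltW.
rewrite -[leRHS]mul1r ler_pdivlMr //.
rewrite -(@ler_pXn2r _ (ell F)) ?ell_gt0 ?nnegrE ?mulr_ge0 ?expectation_threshold_ge0 ?(ltW r0) //.
rewrite expr1n exprMn rX mulrC -mulrA -ler_pdivlMl // mulr1.
exact: covering_dim_expectation_threshold.
Qed.

(** With [d] the covering dimension, (KL)^ell q^ell / 2 < d q^ell <= 1/2, hence (KLq)^ell < 1. *)
Lemma KK_bound_lt1 F (K : R) : upper_set F -> nontrivial F -> 0 < K ->
  2^-1 * (K * log2 (ell F)%:R) ^+ ell F < (covering_dim F)%:R ->
  K * expectation_threshold R F * log2 (ell F)%:R < 1.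
Proof.
move=> Fup Fnt K0 dF; set L := log2 _; set q := expectation_threshold R F.
have L0 : 0 < L by apply: lt_le_trans (log2_ell_ge1 F).
have q0 : 0 <= q := expectation_threshold_ge0 F.
(* Multiplying the strict hypothesis by [q ^+ ell F] keeps it strict only for [q > 0]. *)
have [->|qN0] := eqVneq q 0; first by rewrite mulr0 mul0r.
have qp : 0 < q by rewrite lt_neqAle eq_sym qN0.
have KLq0 : 0 <= K * L * q by apply: mulr_ge0 q0; exact: ltW (mulr_gt0 K0 L0).
rewrite mulrAC -(@ltr_pXn2r _ (ell F)) ?ell_gt0 ?nnegrE //.
have half_gt0 : 0 < 2^-1 :> R by rewrite invr_gt0.
rewrite expr1n exprMn -(ltr_pM2l half_gt0) mulr1 mulrA.
apply: lt_le_trans (covering_dim_expectation_threshold Fup Fnt).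
by rewrite ltr_pM2r ?exprn_gt0.
Qed.

End Covers.

Theorem mainTheorem5 (R : realType) (X : nat -> finType)
    (F : forall n : nat, {set {set X n}}) (K : R)
    (F_upper : forall n : nat, upper_set (F n))
    (F_nontrivial : forall n : nat, nontrivial (F n))
    (K_gt0 : 0 < K)
    (KK : forall n : nat, critical_probability R (F n) <=
        K * expectation_threshold R (F n) * log2 (ell (F n))%:R) :
  ((exists N : nat, forall n : nat, (N <= n)%N ->
      (covering_dim (F n))%:R > 2^-1 * (K * log2 (ell (F n))%:R) ^+ ell (F n)) ->
    KK_nontrivial_information K F) /\
  (negligible_wrt (fun n : nat => log2 (ell (F n))%:R : R)
      (fun n : nat => (2 * (covering_dim (F n))%:R) `^ ((ell (F n))%:R^-1)) ->
    KK_asymptotically_perfect_information K F).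
Proof.
split=> [[N dimF]|].
  by exists N => n /dimF; exact: KK_bound_lt1.
rewrite /negligible_wrt /KK_asymptotically_perfect_information => LF.
set a := (fun n : nat => _ / _) in LF.
(* With L the logarithm, |KL - 1| <= KL + 1 <= (K + 1)L as L >= 1, while the threshold is at most
   the reciprocal of the denominator in [a n]. *)
have bound n :
    `|(K * log2 (ell (F n))%:R - 1) * expectation_threshold R (F n)| <= (K + 1) * a n.
  have := @log2_ell_ge1 _ R (F n).
  have := @expectation_threshold_ge0 _ R (F n).
  have := expectation_threshold_le R (F_upper n) (F_nontrivial n).
  rewrite /a; move: (expectation_threshold R _) (log2 _) (_^-1) => q L r qr q0 L1.
  rewrite normrM (ger0_norm q0) mulrA ler_pM //.
  rewrite (le_trans (ler_normB _ _)) // normr1 mulrDl mul1r lerD //.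
  by rewrite ger0_norm // mulr_ge0 ?(ltW K_gt0) ?(le_trans ler01).
have Ka : (fun n => (K + 1) * a n) @ \oo --> (0 : R).
  by rewrite -(mulr0 (K + 1)); apply: cvgMr.
apply: (@squeeze_cvgr _ _ _ _ (fun n => - ((K + 1) * a n)) (fun n => (K + 1) * a n)) => //.
  by near=> n; rewrite -ler_norml.
by rewrite -oppr0; apply: cvgN.
Unshelve. all: by end_near.
Qed.
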